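(* Let $\bar x\in\mathcal F$ be a local minimizer of the problem $(P)$: minimize $f(x)$ over $x\in C$ subject to $G(x)\in K$. Assume that $X$ is reflexive and that $f$ is weakly sequentially lower semicontinuous in a neighborhood of $\bar x$. Moreover, assume that for all sequences $\{x^k\}\subset C$ and all $x\in C$ the following implication holds: $$x^k\rightharpoonup x\quad\text{and}\quad d_K(G(x^k))\to 0\quad\Longrightarrow\quad G(x)\in K .$$ Then $\bar x$ is an s-AKKT point of $(P)$ and, thus, also a w-AKKT point of $(P)$.
   Context: Setting: $X$ and $Y$ are real Banach spaces, $f\colon X\to\mathbb R$ and $G\colon X\to Y$ are continuously Fréchet differentiable, $C\subset X$ and $K\subset Y$ are nonempty, closed, convex sets. Problem $(P)$: minimize $f(x)$ over $x\in C$ subject to $G(x)\in K$; its feasible set is $\mathcal F:=\{x\in C\mid G(x)\in K\}$. $d_K(y)=\operatorname{dist}(y,K)=\inf_{z\in K}\|y-z\|_Y$. Strong, weak and weak* convergence of sequences are denoted $\to,\rightharpoonup,\rightharpoonup^*$. The normal cone is $\mathcal N_C(x):=\{v\in X^*\mid \langle v,z-x\rangle_X\le 0\ \forall z\in C\}$ for $x\in C$ and $\mathcal N_C(x):=\varnothing$ for $x\notin C$. The Lagrangian is $L(x,\lambda):=f(x)+\langle\lambda,G(x)\rangle_Y$ for $x\in X$, $\lambda\in Y^*$; thus $L'_x(x,\lambda)=f'(x)+G'(x)^*\lambda$. A sequence $\{(x^k,\lambda^k)\}\subset C\times Y^*$ is an s-AKKT sequence if there are sequences $\{\varepsilon^k\}\subset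 X^*$ and $\{r^k\}\subset[0,+\infty)$ with $\varepsilon^k\to0$ in $X^*$ and $r^k\to 0$ such that for all $k\in\mathbb N$: $\varepsilon^k-L'_x(x^k,\lambda^k)\in\mathcal N_C(x^k)$ and $\langle\lambda^k,y-G(x^k)\rangle_Y\le r^k$ for all $y\in K$. It is a w-AKKT sequence if the same holds with $\varepsilon^k\rightharpoonup^*0$ instead of $\varepsilon^k\to0$. A feasible point $\bar x\in\mathcal F$ is an s-AKKT point if there is an s-AKKT sequence $\{(x^k,\lambda^k)\}$ with $x^k\to\bar x$; it is a w-AKKT point if there is a w-AKKT sequence $\{(x^k,\lambda^k)\}$ with $x^k\rightharpoonup\bar x$. *)

(* Defs.v *)
From HB Require Import structures.
From mathcomp Require Import all_boot all_order all_algebra.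
From mathcomp Require Import all_classical all_reals all_analysis.

Set Implicit Arguments.
Unset Strict Implicit.
Unset Printing Implicit Defensive.

Import Order.TTheory GRing.Theory Num.Theory.
Import numFieldNormedType.Exports.

Local Open Scope classical_set_scope.
Local Open Scope ring_scope.

Section BoundedOperators.
Context {R : realType} {X Y : normedModType R}.

Definition bop_pred : {pred X -> Y} :=
  [pred T : X -> Y | `[< linear T /\ continuous T >]].

Lemma bop_predP (T : X -> Y) :
  reflect (linear T /\ continuous T) (T \in bop_pred).
Proof. by rewrite inE; exact: asboolP. Qed.

Lemma bop_submod_closed : subsemimod_closed bop_pred.
Proof.
split; [split|].
- apply/bop_predP; split; last by move=> x; exact: cvg_cst.
  by move=> a x y; change (0 = a *: 0 + 0 :> Y); rewrite scaler0 addr0.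
- move=> S T /bop_predP[lS cS] /bop_predP[lT cT]; apply/bop_predP; split.
    move=> a x y.
    change (S (a *: x + y) + T (a *: x + y) = a *: (S x + T x) + (S y + T y)).
    by rewrite lS lT scalerDr addrACA.
  by move=> x; apply: cvgD; [exact: cS | exact: cT].
- move=> a T /bop_predP[lT cT]; apply/bop_predP; split.
    move=> b x y; change (a *: T (b *: x + y) = b *: (a *: T x) + a *: T y).
    by rewrite lT scalerDr !scalerA mulrC.
  by move=> x; apply: cvgZr; exact: cT.
Qed.

HB.instance Definition _ :=
  GRing.isSubmodClosed.Build R (X -> Y) bop_pred bop_submod_closed.

Record bop := Bop { bop_fun :> X -> Y ; bop_funP : bop_fun \in bop_pred }.

HB.instance Definition _ := [isSub for bop_fun].
HB.instance Definition _ := [Choice of bop by <:].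
HB.instance Definition _ := [SubChoice_isSubLmodule of bop by <:].

Implicit Types S T : bop.

Lemma bop_linear T : linear T.
Proof. by have /bop_predP[] := bop_funP T. Qed.

Lemma bop_continuous T : continuous T.
Proof. by have /bop_predP[] := bop_funP T. Qed.

HB.instance Definition _ T := GRing.isLinear.Build R X Y _ T (bop_linear T).

Lemma bopP S T : (forall x, S x = T x) -> S = T.
Proof. by move=> ST; apply: val_inj; apply/funext. Qed.

Lemma bopD S T x : (S + T) x = S x + T x. Proof. by []. Qed.
Lemma bopZ (a : R) T x : (a *: T) x = a *: T x. Proof. by []. Qed.

Definition opnorm T : R := sup [set `|T x| | x in [set x : X | `|x| <= 1]].

Let opset T : set R := [set `|T x| | x in [set x : X | `|x| <= 1]].

Let opset_neq0 T : opset T !=set0.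
Proof. by exists `|T 0|, 0 => //=; rewrite normr0 ler01. Qed.

Let opset_bounded T : has_ubound (opset T).
Proof.
have /linear_bounded_continuous/bounded_funP/(_ 1)[M MT] :
  continuous (T : {linear X -> Y}) by exact: bop_continuous.
by exists M => _ [x x1 <-]; exact: MT.
Qed.

Lemma opnorm_ub T x : `|x| <= 1 -> `|T x| <= opnorm T.
Proof. by move=> x1; apply: ub_le_sup; [exact: opset_bounded | exists x]. Qed.

Lemma opnorm_le T M : (forall x, `|x| <= 1 -> `|T x| <= M) -> opnorm T <= M.
Proof.
by move=> TM; apply: ge_sup; [exact: opset_neq0 | move=> _ [x x1 <-]; exact: TM].
Qed.

Lemma opnorm_ge0 T : 0 <= opnorm T.
Proof. by apply: (le_trans (normr_ge0 (T 0))); rewrite opnorm_ub// normr0 ler01. Qed.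

Lemma le_opnorm T x : `|T x| <= opnorm T * `|x|.
Proof.
have [->|x0] := eqVneq x 0; first by rewrite linear0 !normr0 mulr0.
have nx : 0 < `|x| by rewrite normr_gt0.
have := @opnorm_ub T (`|x|^-1 *: x).
rewrite linearZ/= !normrZ normfV normr_id mulVf ?gt_eqF// => /(_ (lexx _)).
by rewrite ler_pdivrMl// mulrC.
Qed.

Lemma opnormD S T : opnorm (S + T) <= opnorm S + opnorm T.
Proof.
apply: opnorm_le => x x1; rewrite bopD (le_trans (ler_normD _ _))//.
by rewrite lerD ?opnorm_ub.
Qed.

Lemma opnormZ (a : R) T : opnorm (a *: T) = `|a| * opnorm T.
Proof.
have opZ b S : opnorm (b *: S) <= `|b| * opnorm S.
  apply: opnorm_le => x x1.
  by rewrite bopZ normrZ ler_wpM2l ?normr_ge0 ?opnorm_ub.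
apply/eqP; rewrite eq_le opZ/=.
have [->|a0] := eqVneq a 0; first by rewrite normr0 mul0r opnorm_ge0.
have := opZ a^-1 (a *: T); rewrite scalerA mulVf// scale1r normfV.
by rewrite ler_pdivlMl ?normr_gt0.
Qed.

Lemma opnorm_eq0 T : opnorm T = 0 -> T = 0.
Proof.
move=> T0; apply: bopP => x; apply/eqP; rewrite -normr_le0.
by rewrite (le_trans (le_opnorm T x))// T0 mul0r.
Qed.

HB.instance Definition _ :=
  @Lmodule_isNormed.Build R bop opnorm opnormD opnormZ opnorm_eq0.

Lemma opnormE T :
  `|T| = sup [set `|T x| | x in [set x : X | `|x| <= 1]].
Proof. by []. Qed.

End BoundedOperators.

Arguments bop {R} X Y.
Arguments bop_pred {R} X Y.

Definition dual {R : realType} (X : normedModType R) := bop X R.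

(* The canonical embedding of X into its bidual is onto. *)
Definition reflexive_space {R : realType} (X : normedModType R) : Prop :=
  forall phi : dual (dual X), exists x : X, forall l : dual X, phi l = l x.

Definition weak_cvg {R : realType} {X : normedModType R}
    (u : X^nat) (x : X) : Prop :=
  forall l : dual X, l (u k) @[k --> \oo] --> l x.

Definition weak_star_cvg {R : realType} {X : normedModType R}
    (u : (dual X)^nat) (l : dual X) : Prop :=
  forall x : X, u k x @[k --> \oo] --> l x.

(* f is weakly sequentially lower semicontinuous on U: both the sequence and
   its weak limit are taken in U. *)
Definition weakly_seq_lsc_on {R : realType} {X : normedModType R}
    (U : set X) (f : X -> R) : Prop :=
  forall (u : X^nat) (x : X), (forall k, U (u k)) -> U x -> weak_cvg u x ->
    ((f x)%:E <= limn_einf (fun k => (f (u k))%:E))%E.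

Section FrechetDerivative.
Context {R : realType} {X Y : normedModType R}.

(* The differential 'd F x as an element of bop X Y; the default value 0 is
   only taken when F is not differentiable at x, see fderiveE. *)
Definition fderive (F : X -> Y) (x : X) : bop X Y :=
  insubd (0 : bop X Y) ('d F x : X -> Y).

Lemma fderiveE (F : X -> Y) (x : X) :
  differentiable F x -> fderive F x = 'd F x :> (X -> Y).
Proof.
move=> dF; apply: (@insubdK (X -> Y) (bop_pred X Y) (bop X Y)).
apply/bop_predP; split; last exact: diff_continuous.
by move=> a u v; exact: linearP.
Qed.

(* Continuity of the derivative is with respect to the operator norm. *)
Definition continuously_differentiable (F : X -> Y) : Prop :=
  (forall x, differentiable F x) /\ continuous (fderive F).

End FrechetDerivative.

Definition dist_set {R : realType} {Y : normedModType R} (K : set Y) (y : Y) : R :=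
  inf [set `|y - z| | z in K].

Definition normal_cone {R : realType} {X : normedModType R}
    (C : set X) (x : X) : set (dual X) :=
  [set v | C x /\ forall z, C z -> v (z - x) <= 0].

Section OptimizationProblem.
Context {R : realType} {X Y : normedModType R}.
Variables (f : X -> R) (G : X -> Y) (C : set X) (K : set Y).

Definition feasible : set X := [set x | C x /\ K (G x)].

Definition local_minimizer (xbar : X) : Prop :=
  feasible xbar /\ \forall x \near xbar, feasible x -> f xbar <= f x.

Definition lagrangian (x : X) (lambda : dual Y) : R := f x + lambda (G x).

Definition lagrangian_dx (x : X) (lambda : dual Y) : dual X :=
  fderive (lagrangian^~ lambda) x.

(* L'_x(x, lambda) = f'(x) + G'(x)^* lambda *)
Lemma lagrangian_dxE (x : X) (lambda : dual Y) (h : X) :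
  differentiable f x -> differentiable G x ->
  lagrangian_dx x lambda h = fderive f x h + lambda (fderive G x h).
Proof.
move=> df dG.
have dl : is_diff (G x) lambda lambda.
  apply: DiffDef; first exact/linear_differentiable/bop_continuous.
  exact/diff_lin/bop_continuous.
have dfx := differentiableP df; have dGx := differentiableP dG.
have dlG := is_diff_comp dGx dl.
have dL := is_diffD dfx dlG.
have dLx : differentiable (lagrangian^~ lambda) x.
  exact: (@ex_diff _ _ _ _ _ _ _ dL).
have dLE : 'd (lagrangian^~ lambda) x = (fun h => 'd f x h + lambda ('d G x h))
    :> (X -> R).
  exact: (@diff_val _ _ _ _ _ _ _ dL).
have fE := congr1 (@^~ h) (fderiveE df).
have GE := congr1 (@^~ h) (fderiveE dG).
have LE := congr1 (@^~ h) (etrans (fderiveE dLx) dLE).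
by apply: (etrans LE); rewrite /= -[in LHS]fE -[in LHS]GE.
Qed.

(* The conditions common to s- and w-AKKT sequences, for a given sequence eps
   whose mode of convergence to 0 distinguishes the two notions. *)
Definition AKKT_conditions (x : X^nat) (lambda : (dual Y)^nat)
    (eps : (dual X)^nat) (r : R^nat) : Prop :=
  [/\ forall k, C (x k),
      forall k, 0 <= r k,
      r @ \oo --> (0 : R) &
      forall k, normal_cone C (x k) (eps k - lagrangian_dx (x k) (lambda k)) /\
                forall y, K y -> lambda k (y - G (x k)) <= r k].

Definition s_AKKT_sequence (x : X^nat) (lambda : (dual Y)^nat) : Prop :=
  exists (eps : (dual X)^nat) (r : R^nat),
    eps @ \oo --> (0 : dual X) /\ AKKT_conditions x lambda eps r.

Definition w_AKKT_sequence (x : X^nat) (lambda : (dual Y)^nat) : Prop :=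
  exists (eps : (dual X)^nat) (r : R^nat),
    weak_star_cvg eps 0 /\ AKKT_conditions x lambda eps r.

Definition s_AKKT_point (xbar : X) : Prop :=
  feasible xbar /\ exists (x : X^nat) (lambda : (dual Y)^nat),
    s_AKKT_sequence x lambda /\ x @ \oo --> xbar.

Definition w_AKKT_point (xbar : X) : Prop :=
  feasible xbar /\ exists (x : X^nat) (lambda : (dual Y)^nat),
    w_AKKT_sequence x lambda /\ weak_cvg x xbar.

End OptimizationProblem.

(* Main.v *)
(* For fixed [e > 0] and [k], Ekeland's principle started at [xbar] yields a
   point [x_k] of [C], in a fixed closed ball around [xbar], with
   [f x_k + k d_K(G x_k) + e |x_k - xbar| <= f xbar] and which minimizes
   [f + k d_K(G .) + e |. - x_k|] over that part of [C].  If the [x_k] stayed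
   away from [xbar], a subsequence would converge weakly to some [y], feasible
   because [d_K(G x_k) -> 0], and weak lower semicontinuity would give
   [f y < f xbar].  So some [x_k] is within [e] of [xbar].  Linearizing [f] and
   [G] there leaves a convex optimality condition, which Hahn-Banach splits into
   a subgradient [lambda] of [k d_K] at [G x_k], satisfying
   [lambda (y - G x_k) <= 0] on [K], and a perturbation of norm at most [e].

   Weak sequential compactness is obtained from ultrafilter limits in the
   bidual, together with a countable family of functionals that separates the
   points of the closed span of the sequence. *)

From HB Require Import structures.
Require Import Defs.
From mathcomp Require Import all_boot all_order all_algebra.
From mathcomp Require Import all_classical all_reals all_analysis.
From mathcomp Require Import lra ring.

Set Implicit Arguments.
Unset Strict Implicit.
Unset Printing Implicit Defensive.

Import Order.TTheory GRing.Theory Num.Theory.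
Import numFieldNormedType.Exports.

Local Open Scope classical_set_scope.
Local Open Scope ring_scope.

(** * Infima of convex functions and a convex Hahn-Banach theorem *)

Section InfOver.
Context {R : realType} {I : Type}.
Implicit Types (A : set I) (F : I -> R).

(** On an empty family, or one unbounded below, [inf] is only a default value; hence the explicit
    lower bound [c] in the lemmas below. *)
Definition inf_over A F : R := inf [set F i | i in A].

Lemma inf_over_le A F c i : (forall j, A j -> c <= F j) -> A i ->
  inf_over A F <= F i.
Proof.
move=> cF Ai; apply: ge_inf; last by exists i.
by exists c => _ [j Aj <-]; exact: cF.
Qed.

Lemma le_inf_over A F c : A !=set0 -> (forall j, A j -> c <= F j) ->
  c <= inf_over A F.
Proof.
move=> [i Ai] cF; apply: lb_le_inf; first by exists (F i), i.
by move=> _ [j Aj <-]; exact: cF.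
Qed.

Lemma inf_over_lt A F c e : A !=set0 -> (forall j, A j -> c <= F j) -> 0 < e ->
  exists2 i, A i & F i < inf_over A F + e.
Proof.
move=> [i Ai] cF e0.
have [|_ [j Aj <-] ji] := @inf_adherent _ [set F i | i in A] _ e0.
  by split; [exists (F i), i | exists c => _ [j Aj <-]; exact: cF].
by exists j.
Qed.

Lemma inf_over_ltM A F c s e : A !=set0 -> (forall j, A j -> c <= F j) ->
  0 < s -> 0 < e -> exists2 i, A i & s * F i < s * inf_over A F + e.
Proof.
move=> A0 cF s0 e0.
have [i Ai] := inf_over_lt A0 cF (divr_gt0 e0 s0).
rewrite -(ltr_pM2l s0) mulrDr [s * (e / s)]mulrC divfK ?gt_eqF// => iF.
by exists i.
Qed.

End InfOver.

Section Convexity.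
Context {R : realType} {V : lmodType R}.

Definition convex_on_space (p : V -> R) : Prop := forall x y t, 0 <= t <= 1 ->
  p (t *: x + (1 - t) *: y) <= t * p x + (1 - t) * p y.

Lemma convex_set_comb (A : set V) (x y : V) (t : R) :
  convex_set (A : set (convex_lmodType V)) -> A x -> A y -> 0 <= t <= 1 ->
  A (t *: x + (1 - t) *: y).
Proof.
move=> cA Ax Ay t01.
have /(_ _ _)/[!inE] := cA x y (Itv01 (andP t01).1 (andP t01).2).
by apply.
Qed.

Lemma convex_setP (A : set V) :
  convex_set (A : set (convex_lmodType V)) <->
  forall x y t, 0 <= t <= 1 -> A x -> A y -> A (t *: x + (1 - t) *: y).
Proof.
split=> cA x y t; first by move=> t01 Ax Ay; exact: convex_set_comb.
by rewrite !inE => Ax Ay; apply: cA => //; rewrite ge0 le1.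
Qed.

Lemma combDl (b x y : V) (t : R) :
  b + (t *: x + (1 - t) *: y) = t *: (b + x) + (1 - t) *: (b + y).
Proof.
by rewrite !scalerDr addrACA -scalerDl [t + (1 - t)]addrC subrK scale1r.
Qed.

Lemma combACA (x y x' y' : V) (t : R) :
  (t *: x + (1 - t) *: y) + (t *: x' + (1 - t) *: y') =
  t *: (x + x') + (1 - t) *: (y + y').
Proof. by rewrite !scalerDr addrACA. Qed.

End Convexity.

Section PartialInfimum.
Context {R : realType} {V W : lmodType R}.

(** Near-minimizers [z] for [x] and [w] for [y] combine into a competitor for the combined point.
    This yields convexity of the distance function and of the value function behind the
    multipliers. *)
Lemma convex_partial_inf (A : set W) (N : V -> W -> R) :
  A !=set0 -> convex_set (A : set (convex_lmodType W)) ->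
  (forall x, exists c, forall z, A z -> c <= N x z) ->
  (forall x y z w t, 0 <= t <= 1 -> A z -> A w ->
    N (t *: x + (1 - t) *: y) (t *: z + (1 - t) *: w) <=
      t * N x z + (1 - t) * N y w) ->
  convex_on_space (fun x => inf_over A (N x)).
Proof.
move=> A0 cA lbN cN x y t t01; apply/ler_addgt0Pr => e e0.
have [cx Nx] := lbN x; have [cy Ny] := lbN y.
have [c Nc] := lbN (t *: x + (1 - t) *: y).
have [z Az zx] := inf_over_lt A0 Nx e0.
have [w Aw wy] := inf_over_lt A0 Ny e0.
apply: (le_trans (inf_over_le Nc (convex_set_comb cA Az Aw t01))).
apply: (le_trans (cN _ _ _ _ _ t01 Az Aw)).
have /andP[t0 t1] := t01; nra.
Qed.

End PartialInfimum.

Section HahnBanach.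
Context {R : realType} {V : lmodType R}.

Definition sublinear (p : V -> R) : Prop :=
  (forall x y, p (x + y) <= p x + p y) /\
  (forall t x, 0 < t -> p (t *: x) <= t * p x).

Lemma sublinear0 p : sublinear p -> p 0 = 0.
Proof.
move=> [_ ph]; have := ph 2 0 (ltr0Sn _ _).
have := ph 2^-1 0; rewrite !scaler0 invr_gt0 ltr0n => /(_ isT).
by move=> ? ?; apply/eqP; rewrite eq_le; apply/andP; split; lra.
Qed.

Lemma sublinear_ge p : sublinear p -> forall x, - p (- x) <= p x.
Proof.
move=> ps x; have := ps.1 x (- x).
by rewrite subrr sublinear0// => ?; lra.
Qed.

Lemma sublinear_odd_linear p : sublinear p -> (forall x, p (- x) <= - p x) ->
  forall a x y, p (a *: x + y) = a * p x + p y.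
Proof.
move=> ps pN.
have pNE x : p (- x) = - p x.
  by apply/eqP; rewrite eq_le pN/= lerNl sublinear_ge.
have pD x y : p (x + y) = p x + p y.
  apply/eqP; rewrite eq_le ps.1/=.
  have := ps.1 (x + y) (- y); rewrite addrK pNE => ?; lra.
have pZ t x : 0 < t -> p (t *: x) = t * p x.
  move=> t0; apply/eqP; rewrite eq_le ps.2//=.
  have := ps.2 t (- x) t0; rewrite scalerN !pNE => ?; lra.
move=> a x y; rewrite pD; congr (_ + _).
have [a0|a0|->] := ltgtP a 0; last by rewrite scale0r mul0r sublinear0.
  by rewrite -[a]opprK scaleNr pNE pZ ?oppr_gt0// !mulNr.
by rewrite pZ.
Qed.

(* Replacing [q] by the infimum of [q (x + t v) - t q v] over [t >= 0]
   does not change a minimal sublinear [q]; at [x = - v] and [t = 1]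
   this gives [q (- v) <= - q v]. *)
Lemma minimal_sublinear_odd q : sublinear q ->
  (forall r, sublinear r -> (forall x, r x <= q x) -> forall x, q x <= r x) ->
  forall v, q (- v) <= - q v.
Proof.
move=> qs qmin v.
pose T := [set t : R | 0 <= t].
pose F x t := q (x + t *: v) - t * q v.
have T0 : T !=set0 by exists 0; rewrite /T /=.
have qZ t : 0 <= t -> q (t *: v) <= t * q v.
  rewrite le_eqVlt => /predU1P[<-|t0]; last exact: qs.2.
  by rewrite scale0r sublinear0// mul0r.
have qZ' t : 0 <= t -> t * q v <= q (t *: v).
  rewrite le_eqVlt => /predU1P[<-|t0].
    by rewrite scale0r sublinear0// mul0r.
  have := qs.2 t^-1 (t *: v); rewrite invr_gt0 t0 => /(_ isT).
  by rewrite scalerA mulVf ?gt_eqF// scale1r ler_pdivlMl.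
have lbF x t : T t -> - q (- x) <= F x t.
  move=> /= t0; have := qs.1 (x + t *: v) (- x).
  rewrite addrAC subrr add0r /F => ?; have := qZ' t t0; lra.
have rs : sublinear (fun x => inf_over T (F x)).
  split=> [x y|s x s0].
    apply/ler_addgt0Pr => e e0.
    have e2 : 0 < e / 2 by lra.
    have [t Tt xt] := inf_over_lt T0 (lbF x) e2.
    have [s Ts ys] := inf_over_lt T0 (lbF y) e2.
    have Tts : T (t + s) by apply: addr_ge0.
    apply: (le_trans (inf_over_le (lbF (x + y)) Tts)).
    have := qs.1 (x + t *: v) (y + s *: v).
    rewrite addrACA -scalerDl; move: xt ys; rewrite /F => ? ? ?; lra.
  apply/ler_addgt0Pr => e e0.
  have [t Tt xt] := inf_over_ltM T0 (lbF x) s0 e0.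
  have Tst : T (s * t) by apply: mulr_ge0 => //; exact: ltW.
  apply: (le_trans (inf_over_le (lbF (s *: x)) Tst)).
  have := qs.2 s (x + t *: v) s0; rewrite scalerDr scalerA.
  move: xt; rewrite /F mulrBr mulrA => ? ?; lra.
have rq x : inf_over T (F x) <= q x.
  have := inf_over_le (lbF x) (lexx (0 : R) : T 0).
  by rewrite /F scale0r addr0 mul0r subr0.
apply: (le_trans (qmin _ rs rq (- v))).
have := inf_over_le (lbF (- v)) (ler01 : T 1).
by rewrite /F scale1r addNr sublinear0// mul1r sub0r.
Qed.

(** Zorn's lemma for the reversed pointwise order. A nonempty chain is bounded by its pointwise
    infimum, finite because a sublinear [q <= p] satisfies [q x >= - p (- x)]. *)
Lemma exists_minimal_sublinear p : sublinear p ->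
  exists q, [/\ sublinear q, forall x, q x <= p x &
    forall r, sublinear r -> (forall x, r x <= q x) -> forall x, q x <= r x].
Proof.
move=> ps.
pose T := {q : V -> R | sublinear q /\ forall x, q x <= p x}.
pose rle (q r : T) : bool := `[< forall x, proj1_sig r x <= proj1_sig q x >].
have p0 : T by exists p; split.
have [||A tA|[q [qs qp]] qmax] := @ZL_preorder T p0 rle.
- by move=> q; apply/asboolP => x.
- move=> r q s /asboolP rq /asboolP qs; apply/asboolP => x.
  exact: le_trans (qs x) (rq x).
- have [A0|/set0P/negP] := pselect (A !=set0); last first.
    rewrite negbK => /eqP A0.
    by exists p0 => s; rewrite A0.
  have lbA x (q : T) : A q -> - p (- x) <= proj1_sig q x.
    move=> _; case: q => q [qs qp] /=; apply: le_trans (sublinear_ge qs x).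
    by rewrite lerN2.
  pose m x := inf_over A (fun q => proj1_sig q x).
  have ms : sublinear m.
    split=> [x y|t x t0]; apply/ler_addgt0Pr => e e0.
      have e2 : 0 < e / 2 by lra.
      have [q Aq xq] := inf_over_lt A0 (lbA x) e2.
      have [r Ar yr] := inf_over_lt A0 (lbA y) e2.
      (* In a chain, the smaller of the two near-minimizers serves for [x] and [y] at once. *)
      have [s As [sq sr]] : exists2 s : T, A s &
          (forall z, proj1_sig s z <= proj1_sig q z) /\
          (forall z, proj1_sig s z <= proj1_sig r z).
        by have [/asboolP qr|/asboolP rq] := tA q r Aq Ar;
           [exists r|exists q].
      apply: (le_trans (inf_over_le (lbA (x + y)) As)).
      have := (proj2_sig s).1.1 x y; have := sq x; have := sr y.
      by move=> ? ? ?; rewrite /m; lra.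
    have [q Aq /ltW xq] := inf_over_ltM A0 (lbA x) t0 e0.
    apply: (le_trans (inf_over_le (lbA (t *: x)) Aq)).
    exact: (le_trans ((proj2_sig q).1.2 t x t0)).
  have mp x : m x <= p x.
    case: A0 => q Aq; apply: le_trans ((proj2_sig q).2 x).
    exact: (inf_over_le (lbA x) Aq).
  exists (exist _ m (conj ms mp)) => q Aq; apply/asboolP => x /=.
  exact: (inf_over_le (lbA x) Aq).
exists q; split=> // r rs rq x.
have rp y : r y <= p y by exact: le_trans (rq y) (qp y).
have /asboolP := qmax (exist _ r (conj rs rp)) (asboolT rq).
exact.
Qed.

Lemma sublinear_minorant p : sublinear p -> exists l : V -> R,
  (forall a x y, l (a *: x + y) = a * l x + l y) /\ forall x, l x <= p x.
Proof.
move=> /exists_minimal_sublinear[q [qs qp qmin]]; exists q; split=> //.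
exact/sublinear_odd_linear/minimal_sublinear_odd.
Qed.

(** The infimum of [p (t x) / t] over [t > 0] is sublinear and, by the choice [t = 1], lies below
    [p]; so its linear minorants are minorants of [p]. *)
Lemma hahn_banach_convex p : convex_on_space p -> 0 <= p 0 ->
  exists l : V -> R,
    (forall a x y, l (a *: x + y) = a * l x + l y) /\ forall x, l x <= p x.
Proof.
move=> cp p0.
pose T := [set t : R | 0 < t].
pose F x t := p (t *: x) / t.
have T0 : T !=set0 by exists 1; rewrite /T/=.
have lbF x t : T t -> - p (- x) <= F x t.
  rewrite /T/= => t0; rewrite /F ler_pdivlMr// mulNr -subr_ge0 opprK.
  have t1 : 0 < 1 + t by lra.
  (* The origin is the combination of [t x] and [- x] with weights [1 / (1 + t)] and [t / (1 + t)],
     so [0 <= p 0] bounds the quotients from below. *)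
  have /(cp (t *: x) (- x)) : 0 <= (1 + t)^-1 <= 1.
    by rewrite invr_ge0 ltW//= invf_le1//; lra.
  have -> : 1 - (1 + t)^-1 = (1 + t)^-1 * t by field; lra.
  rewrite scalerN scalerA subrr => /(le_trans p0).
  by rewrite -mulrA -mulrDr pmulr_rge0 ?invr_gt0// [t * _]mulrC.
have Ps : sublinear (fun x => inf_over T (F x)).
  split=> [x y|s x s0]; apply/ler_addgt0Pr => e e0.
    have e2 : 0 < e / 2 by lra.
    have [t Tt xt] := inf_over_lt T0 (lbF x) e2.
    have [s Ts ys] := inf_over_lt T0 (lbF y) e2.
    rewrite /T/= in Tt Ts.
    have ts : 0 < t + s by lra.
    (* With weights [s / (t + s)] and [t / (t + s)], the points [t x] and [s y] combine to exactly
       this multiple of [x + y]. *)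
    have Tts : T (t * s / (t + s)) by rewrite /T/= divr_gt0// mulr_gt0.
    apply: (le_trans (inf_over_le (lbF (x + y)) Tts)).
    have /(cp (t *: x) (s *: y)) : 0 <= s / (t + s) <= 1.
      by rewrite ltW ?divr_gt0//= ler_pdivrMr//; lra.
    have -> : 1 - s / (t + s) = t / (t + s) by field; lra.
    rewrite !scalerA.
    have -> : s / (t + s) * t = t * s / (t + s) by ring.
    have -> : t / (t + s) * s = t * s / (t + s) by ring.
    rewrite -scalerDr => cxy.
    suff : F (x + y) (t * s / (t + s)) <= F x t + F y s by lra.
    rewrite /F ler_pdivrMr//; apply: (le_trans cxy).
    rewrite le_eqVlt; apply/orP; left; apply/eqP; field.
    by rewrite !gt_eqF.
  have [t Tt xt] := inf_over_ltM T0 (lbF x) s0 e0.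
  have Tts : T (t / s) by rewrite /T/= divr_gt0.
  apply: (le_trans (inf_over_le (lbF (s *: x)) Tts)).
  rewrite /F scalerA divfK ?gt_eqF// invf_div mulrCA.
  exact: ltW.
have [l [ll lP]] := sublinear_minorant Ps; exists l; split=> // x.
apply: (le_trans (lP x)).
have := inf_over_le (lbF x) (ltr01 : T 1).
by rewrite /F scale1r divr1.
Qed.

End HahnBanach.

(** * Subgradients, separation and the distance function *)

Lemma bop_scale (R : realType) (X Y : normedModType R) (T : bop X Y) t x :
  T (t *: x) = t *: T x.
Proof.
by rewrite -[t *: x]addr0 bop_linear (linear0 (T : {linear X -> Y})) addr0.
Qed.

Section Functionals.
Context {R : realType} {X : normedModType R}.

(** Turns the bare linear functions of Hahn-Banach into elements of the dual; the one-sided bound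
    suffices because [l (- x) = - l x]. *)
Lemma bounded_linear_dual (l : X -> R) M : 0 <= M ->
  (forall a x y, l (a *: x + y) = a * l x + l y) ->
  (forall x, l x <= M * `|x|) ->
  exists2 T : dual X, `|T| <= M & forall x, T x = l x.
Proof.
move=> M0 ll lM.
have lN x : l (- x) = - l x.
  have l0 : l 0 = 0 by have := ll 1 0 0; rewrite scaler0 addr0 => ?; lra.
  by have := ll (-1) x 0; rewrite addr0 scaleN1r l0 addr0 mulN1r.
have laM x : `|l x| <= M * `|x|.
  rewrite ler_norml lM andbT lerNl -lN; apply: (le_trans (lM _)).
  by rewrite normrN.
pose HL := GRing.isLinear.Build R X R *:%R l ll.
pose L : {linear X -> R} := HB.pack l HL.
have cL : continuous L.
  apply/linear_bounded_continuous/bounded_funP => r; exists (M * r) => x xr.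
  by apply: (le_trans (laM x)); rewrite ler_wpM2l.
have lP : l \in bop_pred X R by apply/bop_predP; split.
exists (Bop lP) => //; apply: opnorm_le => x x1.
by apply: (le_trans (laM x)); rewrite ler_piMr.
Qed.

Lemma dualB (l : dual X) x y : l (x - y) = l x - l y.
Proof. exact: (linearB (l : {linear X -> R})). Qed.

Lemma le_dual_norm (l : dual X) x : l x <= `|l| * `|x|.
Proof. exact: le_trans (ler_norm _) (le_opnorm l x). Qed.

Lemma convex_norm : convex_on_space (fun x : X => `|x|).
Proof.
move=> x y t /andP[t0 t1]; apply: (le_trans (ler_normD _ _)).
by rewrite !normrZ !ger0_norm ?subr_ge0.
Qed.

Lemma convex_ball (x : X) (d : R) :
  convex_set ([set z : X | `|x - z| <= d] : set (convex_lmodType X)).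
Proof.
apply/convex_setP => z w t t01 /= zd wd.
have /andP[t0 t1] := t01.
rewrite distrC addrC combDl; apply: (le_trans (convex_norm _ _ t01)).
rewrite ![- x + _]addrC ![`|_ - x|]distrC.
have := ler_wpM2l t0 zd; have := @ler_wpM2l _ (1 - t) _ _ _ wd.
by rewrite subr_ge0 => /(_ t1); lra.
Qed.

(** The convex Hahn-Banach theorem applies to [g (w + y) - g y], which vanishes at [w = 0]; the
    Lipschitz constant bounds the norm of the minorant. *)
Lemma exists_subgradient (g : X -> R) k y : 0 <= k -> convex_on_space g ->
  (forall u v, g u - g v <= k * `|u - v|) ->
  exists2 l : dual X, `|l| <= k & forall w, l (w - y) <= g w - g y.
Proof.
move=> k0 cg gk.
have [||l [ll lg]] := @hahn_banach_convex _ _ (fun w => g (w + y) - g y).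
- move=> u v t t01 /=; have := cg (u + y) (v + y) t t01.
  rewrite !scalerDr addrACA -scalerDl addrCA subrr addr0 scale1r => ?; lra.
- by rewrite add0r subrr.
have [|l' l'k l'E] := bounded_linear_dual k0 ll.
  by move=> x; apply: (le_trans (lg x)); apply: (le_trans (gk _ _));
     rewrite addrK.
by exists l' => // w; rewrite l'E; apply: (le_trans (lg _)); rewrite /= subrK.
Qed.

(** A subgradient of the norm at [y], tested at the origin. *)
Lemma exists_norming (y : X) : exists2 l : dual X, `|l| <= 1 & `|y| <= l y.
Proof.
have [|l l1 ly] := @exists_subgradient (fun x => `|x|) 1 y ler01 convex_norm.
  by move=> u v; rewrite mul1r lerBDr -{1}[u](subrK v) ler_normD.
exists l => //; have := ly 0.
by rewrite dualB (linear0 (l : {linear X -> R})) normr0 !sub0r lerN2.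
Qed.

End Functionals.

Section DistSet.
Context {R : realType} {X : normedModType R}.
Implicit Type S : set X.

Lemma dist_set_le S x z : S z -> dist_set S x <= `|x - z|.
Proof. exact: (@inf_over_le _ _ S (fun z => `|x - z|) 0). Qed.

Lemma dist_set_ge0 S x : S !=set0 -> 0 <= dist_set S x.
Proof. by move=> S0; exact: (@le_inf_over _ _ S (fun z => `|x - z|) 0). Qed.

Lemma dist_set_eq0 S x : S x -> dist_set S x = 0.
Proof.
move=> Sx; apply/eqP; rewrite eq_le dist_set_ge0; last by exists x.
by rewrite andbT (le_trans (dist_set_le x Sx))// subrr normr0.
Qed.

Lemma dist_set_lt S x e : S !=set0 -> dist_set S x < e ->
  exists2 z, S z & `|x - z| < e.
Proof.
move=> S0 xe.
have [||z Sz] := @inf_over_lt _ _ S (fun z => `|x - z|) 0 (e - dist_set S x) S0.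
- by [].
- by rewrite subr_gt0.
rewrite -[inf_over _ _]/(dist_set S x) [dist_set S x + _]addrC subrK => xz.
by exists z.
Qed.

Lemma dist_set_lipschitz S x y : S !=set0 ->
  dist_set S x - dist_set S y <= `|x - y|.
Proof.
move=> S0; rewrite lerBlDl; apply/ler_addgt0Pr => e e0.
have [|z Sz yz] := @dist_set_lt S y (dist_set S y + e) S0.
  by rewrite ltrDl.
apply: (le_trans (dist_set_le x Sz)); apply: (le_trans (ler_distD y _ _)).
lra.
Qed.

Lemma continuous_dist_set S :
  S !=set0 -> continuous (dist_set S).
Proof.
move=> S0 y; apply/cvgrPdist_lt => e e0.
near=> z; have : `|y - z| < e by near: z; exact: cvgr_dist_lt.
apply: le_lt_trans; rewrite ler_norml dist_set_lipschitz// andbT.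
by rewrite lerNl opprB distrC dist_set_lipschitz.
Unshelve. all: by end_near.
Qed.

Lemma convex_dist_set S :
  S !=set0 -> convex_set (S : set (convex_lmodType X)) ->
  convex_on_space (dist_set S).
Proof.
move=> S0 cS; apply: (@convex_partial_inf _ _ _ S (fun x z => `|x - z|)) => //.
  by move=> x; exists 0.
move=> x y z w t t01 _ _.
by rewrite opprD addrACA -!scalerBr; exact: convex_norm.
Qed.

(** A subgradient of the distance function at [x], tested on [S], where the distance vanishes. *)
Lemma separation S x : S !=set0 -> convex_set (S : set (convex_lmodType X)) ->
  exists l : dual X, forall c, S c -> l (c - x) <= - dist_set S x.
Proof.
move=> S0 cS.
have [|l _ lS] := @exists_subgradient _ _ _ 1 x ler01 (convex_dist_set S0 cS).
  by move=> u v; rewrite mul1r; exact: dist_set_lipschitz.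
by exists l => c Sc; rewrite (le_trans (lS c))// (dist_set_eq0 Sc) sub0r.
Qed.

(** Mazur's argument: a functional separating [x] from [S] would keep a gap of [dist_set S x] along
    [u]. The filter is general so that sequences and ultrafilters are both covered. *)
Lemma weak_limit_dist_set (T : Type) (F : set_system T) {PF : ProperFilter F}
    S (u : T -> X) x : S !=set0 -> convex_set (S : set (convex_lmodType X)) ->
  (\forall k \near F, S (u k)) ->
  (forall l : dual X, l (u k) @[k --> F] --> l x) -> dist_set S x = 0.
Proof.
move=> S0 cS Su ux; apply/eqP; rewrite eq_le dist_set_ge0// andbT leNgt.
apply/negP => x0; have [l lS] := separation x S0 cS.
have /cvgrPdist_lt/(_ _ x0) lux := ux l.
have [k [Suk]] := filter_ex (filterI Su lux).
have := lS _ Suk; rewrite dualB.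
by have := ler_norm (l x - l (u k)); lra.
Qed.

Lemma closed_dist_set0 S x : closed S -> S !=set0 -> dist_set S x = 0 -> S x.
Proof.
move=> cS S0 x0; apply: cS => B /nbhs_ballP[e /= e0 xeB].
have [|z Sz xz] := @dist_set_lt S x e S0; first by rewrite x0.
by exists z; split=> //; apply: xeB; rewrite -ball_normE.
Qed.

End DistSet.

(** * Weak sequential compactness in reflexive spaces *)

Section Ultralimits.
Context {R : realType}.

(** If the preimage of a neighborhood is not in [F], then [F] restricted to its complement is
    proper, and an ultrafilter refining this restriction violates the assumption. *)
Lemma cvg_ultrafilters (T : Type) (V : topologicalType) (F : set_system T)
    (FF : Filter F) (f : T -> V) (p : V) :
  (forall G : set_system T, UltraFilter G -> F `<=` G ->
    f x @[x --> G] --> p) ->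
  f x @[x --> F] --> p.
Proof.
move=> fG A pA; apply: contrapT => nFA.
pose B := ~` (f @^-1` A).
have PB : ProperFilter (within B F).
  apply: Build_ProperFilter => /= FB; apply: nFA.
  have {}FB : F [set x | B x -> set0 x] := FB.
  by apply: (@filterS _ F _ _ _ _ FB) => x /contrapT.
have [G [UG FG]] := ultraFilterLemma PB.
have GB : G B by apply: FG; exact: withinT.
have GA : G (f @^-1` A).
  apply: (fG G UG _ A pA) => C FC; apply: FG.
  suff : F [set x | B x -> C x] by [].
  by apply: filterS FC => x Cx _.
by have [x [Bx Ax]] := filter_ex (filterI GB GA); exact: Bx.
Qed.

Lemma ultra_fmap (T V : Type) (U : set_system T) (f : T -> V) :
  UltraFilter U -> UltraFilter (f x @[x --> U]).
Proof.
move=> UU; split; first exact: fmap_proper_filter.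
move=> G PG UG; apply/seteqP; split=> // A GA.
have [//|UnA] := in_ultra_setVsetC (f @^-1` A) UU.
have GnA : G (~` A) by exact: UG.
by have [x [Ax nAx]] := filter_ex (filterI GA GnA).
Qed.

Lemma bounded_ultra_cvg (T : Type) (U : set_system T) (UU : UltraFilter U)
    (h : T -> R) (M : R) : (forall k, `|h k| <= M) ->
  exists2 a : R, `|a| <= M & h k @[k --> U] --> a.
Proof.
move=> hM; have := @segment_compact R (- M) M; rewrite compact_ultra.
move=> /(_ (h x @[x --> U]) (ultra_fmap h UU)) [|a [/= aM ha]].
  suff : U [set k | `[- M, M]%classic (h k)] by [].
  by apply: filterE => k; rewrite /= in_itv/= -ler_norml hM.
by exists a => //; move: aM; rewrite /= in_itv/= -ler_norml.
Qed.

(** The limits of [l (u k)] along [U] exist by boundedness and form a functional on the dual;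
    reflexivity represents it by a point. *)
Lemma reflexive_ultra_weak_cvg (X : normedModType R) (T : Type)
    (U : set_system T) (UU : UltraFilter U) (u : T -> X) (M : R) :
  reflexive_space X -> (forall k, `|u k| <= M) ->
  exists x : X, forall l : dual X, l (u k) @[k --> U] --> l x.
Proof.
move=> Xrefl uM.
have M0 : 0 <= M.
  by have [k _] := filter_ex (@filterT _ U _); apply: le_trans (uM k).
have /choice[phi phiP] (l : dual X) : exists a : R,
    `|a| <= M * `|l| /\ l (u k) @[k --> U] --> a.
  have [|a aM la] := @bounded_ultra_cvg _ _ UU (fun k => l (u k)) (M * `|l|).
    move=> k; apply: (le_trans (le_opnorm l (u k))).
    by rewrite [M * _]mulrC; apply: ler_wpM2l (uM k); exact: opnorm_ge0.
  by exists a.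
have [| |Phi _ PhiE] := @bounded_linear_dual _ (dual X) phi M M0.
- move=> a l m; apply: norm_cvg_unique (phiP (a *: l + m)).2 _ => /=.
  apply: cvgD; last exact: (phiP m).2.
  by apply: cvgMl_tmp; exact: (phiP l).2.
- by move=> l; apply: le_trans (phiP l).1; exact: ler_norm.
have [x xP] := Xrefl Phi; exists x => l.
by rewrite -xP PhiE; exact: (phiP l).2.
Qed.

End Ultralimits.

Section CountableSeparation.
Context {R : realType} {X : normedModType R}.
Variable u : X^nat.

(** Lists of index-coefficient pairs are used so that combinations with rational coefficients can be
    enumerated by [pickle]. *)
Definition lincomb (s : seq (nat * R)) : X := \sum_(p <- s) p.2 *: u p.1.

Lemma lincombD s t : lincomb (s ++ t) = lincomb s + lincomb t.
Proof. exact: big_cat. Qed.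

Lemma lincombZ a s : lincomb [seq (p.1, a * p.2) | p <- s] = a *: lincomb s.
Proof.
rewrite /lincomb big_map scaler_sumr; apply: eq_bigr => p _.
by rewrite scalerA.
Qed.

(** No closure is taken: membership in the closed span is expressed by [dist_set span x = 0]. *)
Definition span : set X := range lincomb.

Lemma span_neq0 : span !=set0. Proof. by exists (lincomb [::]), [::]. Qed.

Lemma span_gen k : span (u k).
Proof. by exists [:: (k, 1)] => //; rewrite /lincomb big_seq1 scale1r. Qed.

Lemma spanZD a x y : span x -> span y -> span (a *: x + y).
Proof.
move=> [s _ <-] [t _ <-]; exists ([seq (p.1, a * p.2) | p <- s] ++ t) => //.
by rewrite lincombD lincombZ.
Qed.

Lemma convex_span : convex_set (span : set (convex_lmodType X)).
Proof.
move=> x y t; rewrite !inE => Sx Sy.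
apply: (spanZD t%:num Sx); rewrite -[X in span X]addr0.
apply: (spanZD _ Sy); exists [::] => //; exact: big_nil.
Qed.

Lemma rational_lincomb s e : 0 < e -> exists q : seq (nat * rat),
  `|lincomb s - lincomb [seq (p.1, ratr p.2) | p <- q]| < e.
Proof.
elim: s e => [|[n a] s IHs] e e0.
  by exists [::]; rewrite subrr normr0.
have e2 : 0 < e / 2 by rewrite divr_gt0.
have [q sq] := IHs _ e2.
(* A coefficient error below [d], multiplied by [|u n|], costs at most [e / 2]; the summand 1 keeps
   the divisor positive. *)
pose d := e / 2 / (1 + `|u n|).
have u1 : 0 < 1 + `|u n| by rewrite ltr_pwDl.
have d0 : 0 < d by rewrite divr_gt0.
have [r] : exists r : rat, ratr r \in `]a, a + d[.
  by apply: rat_in_itvoo; rewrite ltrDl.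
rewrite in_itv/= => /andP[ar rd].
exists ((n, r) :: q) => /=.
rewrite /lincomb !big_cons/= -/(lincomb s) -/(lincomb [seq _ | p <- q]).
rewrite opprD addrACA -scalerBl; apply: (le_lt_trans (ler_normD _ _)).
rewrite [e]splitr ler_ltD// normrZ distrC gtr0_norm ?subr_gt0//.
have : (ratr r - a) * (1 + `|u n|) <= e / 2.
  by rewrite -ler_pdivlMr// lerBlDl ltW.
by apply: le_trans; rewrite ler_wpM2l ?subr_ge0 ?(ltW ar)// lerDr.
Qed.

(** The functionals norm the countably many rational combinations. If they agree on [x] and [y], the
    one norming a combination close to [x - y] vanishes at [x - y], which forces that combination,
    hence [x - y], to be small. *)
Lemma exists_separating_sequence : exists L : nat -> dual X, forall x y,
  dist_set span x = 0 -> dist_set span y = 0 ->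
  (forall m, L m x = L m y) -> x = y.
Proof.
pose c (q : seq (nat * rat)) := lincomb [seq (p.1, ratr p.2) | p <- q].
have /choice[N NP] (q : seq (nat * rat)) : exists l : dual X,
    `|l| <= 1 /\ `|c q| <= l (c q).
  by have [l l1 lq] := exists_norming (c q); exists l.
(* Numbers that decode to no list receive the zero functional. *)
exists (fun m => if unpickle m is Some q then N q else 0) => x y x0 y0 Lxy.
have {}Lxy q : N q x = N q y by have := Lxy (pickle q); rewrite pickleK.
apply/eqP; rewrite -subr_eq0 -normr_le0 leNgt; apply/negP => xy0.
(* The combination found below is within [3 e] of [x - y] and has norm at most [3 e], so
   [|x - y| <= 6 e], a contradiction. *)
pose e := `|x - y| / 7.
have e0 : 0 < e by rewrite divr_gt0.
have [|v Sv xv] := @dist_set_lt _ _ span x e span_neq0; first by rewrite x0.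
have [|w Sw yw] := @dist_set_lt _ _ span y e span_neq0; first by rewrite y0.
have [s _ sE] := spanZD (-1) Sw Sv.
have [q sq] := rational_lincomb s e0.
rewrite -/(c q) sE scaleN1r [- w + v]addrC in sq.
have cxy : `|x - y - c q| <= 3 * e.
  have xyvw : x - y - (v - w) = (x - v) - (y - w).
    by rewrite !opprD !opprK addrACA.
  have := ler_distD (v - w) (x - y) (c q).
  by rewrite xyvw; have := ler_normB (x - v) (y - w); lra.
have [Nq1 Ncq] := NP q.
have Nxy : N q (x - y) = 0.
  by rewrite dualB Lxy subrr.
have : `|c q| <= 3 * e.
  apply: (le_trans Ncq); rewrite -[leLHS]subr0 -Nxy.
  rewrite -dualB.
  apply: (le_trans (le_dual_norm _ _)); rewrite distrC.
  by apply: le_trans cxy; rewrite ler_piMl.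
have := ler_normD (x - y - c q) (c q); rewrite subrK.
by rewrite /e in cxy *; lra.
Qed.

End CountableSeparation.

Section WeakSequentialCompactness.
Context {R : realType} {X : normedModType R}.

(** Let [x] be a weak limit along one ultrafilter. Choosing [sigma j] so that the first [j]
    separating functionals are close to their values at [x], every ultrafilter limit of the
    subsequence agrees with [x] on all of them, hence equals [x]. *)
Lemma reflexive_weak_subsequence (u : X^nat) (M : R) :
  reflexive_space X -> (forall k, `|u k| <= M) ->
  exists (sigma : nat -> nat) (x : X),
    (forall j, (j <= sigma j)%N) /\ weak_cvg (u \o sigma) x.
Proof.
move=> Xrefl uM.
have [U [UU ooU]] := @ultraFilterLemma nat \oo _.
have [x xP] := reflexive_ultra_weak_cvg UU Xrefl uM.
have [L LP] := exists_separating_sequence u.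
have near_L j N : \forall k \near U, forall m, (m < N)%N ->
    `|L m x - L m (u k)| < j.+1%:R^-1.
  elim: N => [|N IHN]; first exact: filterE.
  have /cvgrPdist_lt/(_ j.+1%:R^-1) := xP (L N).
  rewrite invr_gt0 ltr0n => /(_ isT) uN.
  apply: filterS (filterI IHN uN) => k [kN kN1] m.
  by rewrite ltnS leq_eqVlt => /predU1P[->//|]; exact: kN.
have /choice[sigma sigmaP] j : exists k : nat, (j <= k)%N /\
    forall m, (m < j)%N -> `|L m x - L m (u k)| < j.+1%:R^-1.
  have jU := ooU _ (nbhs_infty_ge j).
  by have [k [Lk jk]] := filter_ex (filterI (near_L j j) jU); exists k.
have uL m : L m (u (sigma j)) @[j --> \oo] --> L m x.
  apply/cvgrPdist_lt => e e0; near=> j.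
  apply: (lt_trans ((sigmaP j).2 m _)).
    by near: j; exact: nbhs_infty_gt.
  by near: j; exact: (near_infty_natSinv_lt (PosNum e0)).
exists sigma, x; split=> [j|l]; first by have [] := sigmaP j.
apply: cvg_ultrafilters => G UG ooG.
have [y yP] := reflexive_ultra_weak_cvg UG Xrefl (fun j => uM (sigma j)).
suff -> : x = y by exact: yP.
apply: LP.
- apply: (weak_limit_dist_set (span_neq0 u) (@convex_span _ _ u) _ xP).
  by apply: filterE => k; exact: span_gen.
- apply: (weak_limit_dist_set (span_neq0 u) (@convex_span _ _ u) _ yP).
  by apply: filterE => k; exact: span_gen.
move=> m; apply: norm_cvg_unique (yP (L m)) => /=.
by move=> A /uL; exact: ooG.
Unshelve. all: by end_near.
Qed.

End WeakSequentialCompactness.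

(** * Ekeland's variational principle *)

Section Ekeland.
Context {R : realType} {X : completeNormedModType R}.

(** Each iterate nearly minimizes [phi] over the set [N] of its predecessor. The decrease of [phi]
    controls the distances, so the iterates converge, and the limit lies in all these sets. *)
Lemma ekeland (S : set X) (phi : X -> R) (c e : R) (x0 : X) :
  closed S -> continuous phi -> (forall x, S x -> c <= phi x) -> S x0 ->
  0 < e ->
  exists x, [/\ S x, phi x + e * `|x - x0| <= phi x0 &
    forall z, S z -> phi x <= phi z + e * `|z - x|].
Proof.
move=> cS cphi phic Sx0 e0.
pose N x := [set z | S z /\ phi z + e * `|z - x| <= phi x].
have Nc x z : N x z -> c <= phi z by move=> [/phic].
have Nxx x : S x -> N x x by split=> //; rewrite subrr normr0 mulr0 addr0.
have Ntrans x z w : N x z -> N z w -> N x w.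
  move=> [Sz xz] [Sw zw]; split=> //.
  have : e * `|w - x| <= e * `|w - z| + e * `|z - x|.
    by rewrite -mulrDr ler_wpM2l ?(ltW e0)// ler_distD.
  by move: xz zw; lra.
have /choice[g gP] (p : nat * X) : exists z, S p.2 ->
    N p.2 z /\ phi z < inf_over (N p.2) phi + p.1.+1%:R^-1.
  have [Sp|nSp] := pselect (S p.2); last by exists x0.
  have [|||z Nz zp] := @inf_over_lt _ _ (N p.2) phi c p.1.+1%:R^-1.
  - by exists p.2; exact: Nxx.
  - exact: Nc.
  - by rewrite invr_gt0 ltr0n.
  by exists z.
pose y := fix y n := if n is m.+1 then g (m, y m) else x0.
have Sy n : S (y n) by elim: n => // n Sn; have [[]] := gP (n, y n) Sn.
have yN m n : N (y m) (y (m + n)%N).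
  elim: n => [|n IHn]; first by rewrite addn0; exact: Nxx.
  rewrite addnS; have [Ng _] := gP ((m + n)%N, y (m + n)%N) (Sy _).
  exact: (Ntrans _ _ _ IHn Ng).
have ycvg : cvg (y @ \oo).
  apply/cauchy_cvgP/cauchy_exP => d d0.
  have ed : 0 < e * d by exact: mulr_gt0.
  have phiy n : setT n -> c <= phi (y n) by move=> _; exact/phic/Sy.
  have T0 : [set: nat] !=set0 by exists 0%N.
  have [n _ yn] := inf_over_lt T0 phiy ed.
  exists (y n); exists n => // m /= nm; rewrite -ball_normE /= distrC.
  have [_] := yN n (m - n)%N; rewrite subnKC// => ynm.
  rewrite -(ltr_pM2l e0); have := inf_over_le phiy (I : setT m).
  by move: ynm yn => /=; lra.
pose x := lim (y @ \oo).
have yx : y n @[n --> \oo] --> x by exact: ycvg.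
have Sx : S x.
  by apply: (@closed_cvg _ _ _ _ _ S cS _ _ yx); exact: nearW.
have Nx m : N (y m) x.
  have phiyx : phi (y n) + e * `|y n - y m| @[n --> \oo] -->
      phi x + e * `|x - y m|.
    apply: cvgD; first exact: (@cvg_comp _ _ _ y phi _ _ _ yx (cphi x)).
    by apply: cvgMl_tmp; apply: cvg_norm; apply: cvgB => //; exact: cvg_cst.
  split=> //; apply: (ler_cvg_to phiyx (cvg_cst _)).
  near=> n; have mn : (m <= n)%N by near: n; exact: nbhs_infty_ge.
  by have [_] := yN m (n - m)%N; rewrite subnKC.
exists x; split=> //; first by have [] := Nx 0%N.
move=> z Sz; rewrite leNgt; apply/negP => zx.
(* A strictly better [z] lies in [N x], hence in every [N (y n)], where [phi (y n.+1)] is within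
   [1 / (n + 1)] of the infimum; so [phi x <= phi z]. *)
have Nxz : N x z by split=> //; exact: ltW.
have : phi x <= phi z.
  apply/ler_addgt0Pr => d d0.
  have [n /= nd] := filter_ex (near_infty_natSinv_lt (PosNum d0)).
  have {}nd : n.+1%:R^-1 < d := nd.
  have {gP}[_ yn] := gP (n, y n) (Sy n).
  have {}yn : phi (y n.+1) < inf_over (N (y n)) phi + n.+1%:R^-1 := yn.
  have := inf_over_le (@Nc (y n)) (Ntrans _ _ _ (Nx n) Nxz).
  have [_] := Nx n.+1; have : 0 <= e * `|x - y n.+1| by rewrite mulr_ge0// ltW.
  by move: (n.+1%:R^-1 : R) yn nd => r; lra.
have : 0 <= e * `|z - x| by rewrite mulr_ge0// ltW.
by move: zx; lra.
Unshelve. all: by end_near.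
Qed.

End Ekeland.

(** * Multipliers of a linearized penalty problem *)

Section Multipliers.
Context {R : realType} {X Y : normedModType R}.

(** A linear minorant of a perturbed value function on [X * Y] splits into two components, [- eta]
    and [lambda]. *)
Lemma exists_multipliers (C : set X) (x : X) (a : dual X) (A : bop X Y)
    (g : Y -> R) (y0 : Y) (k e : R) :
  convex_set (C : set (convex_lmodType X)) -> C x -> 0 <= k -> 0 <= e ->
  convex_on_space g -> (forall u v, g u - g v <= k * `|u - v|) ->
  (forall z, C z ->
    0 <= a (z - x) + (g (y0 + A (z - x)) - g y0) + e * `|z - x|) ->
  exists (lambda : dual Y) (eta : dual X), [/\ `|eta| <= e,
    forall y, lambda (y - y0) <= g y - g y0 &
    forall z, C z -> eta (z - x) - (a (z - x) + lambda (A (z - x))) <= 0].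
Proof.
move=> cC Cx k0 e0 cg gk xmin.
(* [p.1] perturbs the argument of the norm and [p.2] that of [g]; the infimum over [C] is
   nonnegative at [p = 0] by [xmin]. *)
pose N (p : X * Y) (z : X) :=
  e * `|p.1 + (z - x)| + (g (y0 + (p.2 + A (z - x))) - g y0) + a (z - x).
have lbN p z : C z -> - (e * `|p.1| + k * `|p.2|) <= N p z.
  move=> Cz; have := xmin z Cz.
  have := gk (y0 + A (z - x)) (y0 + (p.2 + A (z - x))).
  have -> : y0 + A (z - x) - (y0 + (p.2 + A (z - x))) = - p.2.
    by rewrite [y0 + (p.2 + _)]addrCA opprD addrCA subrr addr0.
  have : e * `|z - x| <= e * `|p.1 + (z - x)| + e * `|p.1|.
    rewrite -mulrDr ler_wpM2l//; have := ler_normB (p.1 + (z - x)) p.1.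
    by rewrite [p.1 + _]addrC addrK.
  by rewrite normrN /N; lra.
have cN p q z w t : 0 <= t <= 1 -> C z -> C w ->
    N (t *: p + (1 - t) *: q) (t *: z + (1 - t) *: w) <=
      t * N p z + (1 - t) * N q w.
  move=> t01 Cz Cw.
  rewrite /N -[t *: z + _ - x]addrC combDl ![- x + _]addrC.
  have AE u v : A (t *: u + (1 - t) *: v) = t *: A u + (1 - t) *: A v.
    by rewrite bop_linear bop_scale.
  have aE u v : a (t *: u + (1 - t) *: v) = t * a u + (1 - t) * a v.
    by rewrite bop_linear bop_scale.
  rewrite AE aE !combACA (combDl y0).
  have := cg (y0 + (p.2 + A (z - x))) (y0 + (q.2 + A (w - x))) t t01.
  have := convex_norm (p.1 + (z - x)) (q.1 + (w - x)) t01.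
  by move=> /(ler_wpM2l e0); lra.
pose P p := inf_over C (N p).
have C0 : C !=set0 by exists x.
have cP : convex_on_space P.
  apply: convex_partial_inf => // q.
  by exists (- (e * `|q.1| + k * `|q.2|)) => z; exact: lbN.
have P0 : 0 <= P 0.
  apply: (le_inf_over C0) => z Cz; have := lbN 0 z Cz.
  by rewrite !normr0 !mulr0 addr0 oppr0.
have [l [ll lP]] := hahn_banach_convex cP P0.
have lN p z : C z -> l p <= N p z.
  by move=> Cz; apply: (le_trans (lP p)); exact: (inf_over_le (lbN p)).
have l0 : l 0 = 0 by have := ll 1 0 0; rewrite scaler0 addr0; lra.
have lopp p : l (- p) = - l p.
  by have := ll (-1) p 0; rewrite addr0 scaleN1r l0 => ->; lra.
have l_fst v : l (v, 0) <= e * `|v|.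
  apply: (le_trans (lN _ _ Cx)); rewrite /N subrr.
  by rewrite !(linear0 (A : {linear X -> Y})) !(linear0 (a : {linear X -> R}))
             !addr0 subrr addr0.
have l_snd w : l (0, w) <= g (y0 + w) - g y0.
  apply: (le_trans (lN _ _ Cx)); rewrite /N subrr.
  by rewrite !(linear0 (A : {linear X -> Y})) !(linear0 (a : {linear X -> R}))
             !addr0 normr0 mulr0 add0r.
have [| |lambda _ lambdaE] := @bounded_linear_dual _ Y (fun w => l (0, w)) k k0.
- by move=> b v w; rewrite -ll; congr l; congr pair; rewrite /= scaler0 addr0.
- by move=> w; apply: (le_trans (l_snd w)); apply: (le_trans (gk _ _));
    rewrite [y0 + w]addrC addrK.
have [| |eta etae etaE] := @bounded_linear_dual _ X (fun v => - l (v, 0)) e e0.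
- move=> b v w; rewrite mulrN -opprD -ll; congr (- l _).
  by congr pair; rewrite /= scaler0 addr0.
- move=> v; rewrite -lopp -[`|v|]normrN.
  have -> : - (v, 0) = (- v, 0) :> X * Y by congr pair; exact: oppr0.
  exact: l_fst.
exists lambda, eta; split=> // [y|z Cz].
  by rewrite lambdaE; apply: (le_trans (l_snd _)); rewrite [y0 + _]addrC subrK.
(* This perturbation cancels the norm and the increment of [g], leaving only [a (z - x)]. *)
have := lN (- (z - x, A (z - x))) z Cz.
rewrite lopp /N /= !addNr normr0 mulr0 addr0 subrr add0r add0r.
have -> : (z - x, A (z - x)) = 1 *: (z - x, 0) + (0, A (z - x)) :> X * Y.
  by rewrite scale1r; congr pair; rewrite /= ?addr0 ?add0r.
by rewrite ll mul1r etaE lambdaE; lra.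
Qed.

End Multipliers.

Section Linearization.
Context {R : realType} {X Y : normedModType R}.

Lemma differentiable_approx (Z : normedModType R) (F : X -> Z) (x : X) (e : R) :
  differentiable F x -> 0 < e ->
  \forall h \near (0 : X), `|F (x + h) - (F x + fderive F x h)| <= e * `|h|.
Proof.
move=> dF e0; have /eqaddoP/(_ e e0) := diff_locally dF.
apply: filterS => h /=.
rewrite opprD /= -(fderiveE dF) [x + h]addrC.
by rewrite opprD.
Qed.

(** Compare [x] with [x + t h] for small [t > 0]: convexity bounds the increment of [g] for the step
    [t h] by [t] times that for [h], the linearization errors are small relative to [t], and one
    divides by [t]. *)
Lemma linearized_minimizer (C : set X) (f : X -> R) (G : X -> Y) (g : Y -> R)
    (x : X) (k e : R) :
  convex_set (C : set (convex_lmodType X)) -> C x -> 0 <= k ->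
  convex_on_space g -> (forall u v, g u - g v <= k * `|u - v|) ->
  differentiable f x -> differentiable G x ->
  (\forall z \near x, C z -> f x + g (G x) <= f z + g (G z) + e * `|z - x|) ->
  forall z, C z ->
    0 <= fderive f x (z - x) + (g (G x + fderive G x (z - x)) - g (G x)) +
         e * `|z - x|.
Proof.
move=> cC Cx k0 cg gk df dG xmin z Cz; pose h := z - x; rewrite -/h.
(* After division by [t] the errors are [d |h|] from [f] and [k d |h|] from [G], through the
   Lipschitz constant of [g]. *)
suff near0 d : 0 < d -> 0 <= fderive f x h +
    (g (G x + fderive G x h) - g (G x)) + e * `|h| + d * ((1 + k) * `|h|).
  apply/ler_addgt0Pr => d d0.
  have kh0 : 0 <= (1 + k) * `|h| by rewrite mulr_ge0// addr_ge0.
  have kh1 : 0 < 1 + (1 + k) * `|h| by rewrite ltr_pwDl.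
  apply: (le_trans (near0 _ (divr_gt0 d0 kh1))); rewrite lerD2l.
  by rewrite -mulrA ler_piMr ?(ltW d0)// ler_pdivrMl// mulr1 lerDr.
move=> d0.
have th0 : t *: h @[t --> 0^'+] --> (0 : X).
  rewrite -(scale0r h); apply: cvgZr_tmp.
  exact: cvg_at_right_filter.
have txh : x + t *: h @[t --> 0^'+] --> x.
  by rewrite -[X in _ --> X]addr0; apply: cvgD => //; exact: cvg_cst.
have f_near := th0 _ (differentiable_approx df d0).
have G_near := th0 _ (differentiable_approx dG d0).
have x_near := txh _ xmin.
near (0 : R)^'+ => t.
have t0 : 0 < t by [].
have t1 : t <= 1 by near: t; apply: nbhs_right_le; exact: ltr01.
have ft : `|f (x + t *: h) - (f x + fderive f x (t *: h))| <= d * `|t *: h|.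
  by near: t; exact: f_near.
have Gt : `|G (x + t *: h) - (G x + fderive G x (t *: h))| <= d * `|t *: h|.
  by near: t; exact: G_near.
have Cxth : C (x + t *: h).
  have -> : x + t *: h = t *: z + (1 - t) *: x.
    by rewrite /h scalerBr scalerBl scale1r addrCA addrC -addrA [- _ + _]addrC.
  by apply: convex_set_comb => //; rewrite t1 ltW.
have : f x + g (G x) <=
    f (x + t *: h) + g (G (x + t *: h)) + e * `|x + t *: h - x|.
  by move: Cxth; near: t; exact: x_near.
rewrite [x + _ - x]addrAC subrr add0r normrZ gtr0_norm//.
have Gt' := gk (G (x + t *: h)) (G x + fderive G x (t *: h)).
have := cg (G x + fderive G x h) (G x) t.
rewrite t1 (ltW t0) => /(_ isT).
have -> : t *: (G x + fderive G x h) + (1 - t) *: G x =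
    G x + fderive G x (t *: h).
  rewrite bop_scale scalerDr addrAC -scalerDl.
  by rewrite [t + _]addrC subrK scale1r.
move: ft Gt; rewrite bop_scale normrZ gtr0_norm// ler_norml => /andP[_ ft].
move=> /(ler_wpM2l k0) Gt gt xt; rewrite -(pmulr_rge0 _ t0).
have {ft} : f (x + t *: h) <= f x + t * fderive f x h + d * (t * `|h|).
  by move: ft; rewrite lerBlDl.
by move: (le_trans Gt' Gt) gt xt; lra.
Unshelve. all: by end_near.
Qed.

End Linearization.

(** * Penalized minimizers *)

Section AKKT.
Context {R : realType}.

Lemma limn_einf_le (u : R^nat) c :
  (forall k, u k <= c) -> (limn_einf (fun k => (u k)%:E) <= c%:E)%E.
Proof.
move=> uc; rewrite limn_einf_lim; apply: lime_le; first exact: is_cvg_einfs.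
apply: nearW => n; apply: ereal_inf_le; exists (u n)%:E; rewrite ?lee_fin//.
by exists n => /=.
Qed.

Section PenalizedMinimizers.
Context {X Y : completeNormedModType R}.
Variables (f : X -> R) (G : X -> Y) (C : set X) (K : set Y) (xbar : X).
Hypotheses (f_C1 : continuously_differentiable f)
  (G_C1 : continuously_differentiable G) (C_closed : closed C)
  (C_convex : convex_set (C : set (convex_lmodType X)))
  (K_nonempty : K !=set0)
  (K_convex : convex_set (K : set (convex_lmodType Y)))
  (X_reflexive : reflexive_space X)
  (xbar_min : local_minimizer f G C K xbar)
  (f_wslsc : exists2 U : set X, nbhs xbar U & weakly_seq_lsc_on U f)
  (G_cond : forall (u : X^nat) (x : X), (forall k, C (u k)) -> C x ->
     weak_cvg u x -> dist_set K (G (u k)) @[k --> \oo] --> (0 : R) ->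
     K (G x)).

(** One closed ball serves local minimality, the lower bound required by Ekeland's principle, and
    weak lower semicontinuity; the 1 is an arbitrary tolerance from continuity. *)
Lemma local_minimizer_ball : exists d : R, 0 < d /\
  forall z, `|xbar - z| <= d ->
  [/\ feasible G C K z -> f xbar <= f z, f xbar - 1 <= f z &
      exists2 U : set X, weakly_seq_lsc_on U f &
        forall w, `|xbar - w| <= d -> U w].
Proof.
have [U xU Ulsc] := f_wslsc; have [_ xmin] := xbar_min.
have cf : {for xbar, continuous f} by exact/differentiable_continuous/f_C1.1.
have /cvgrPdist_le/(_ 1 ltr01) fx := cf.
have [d dP] := (nbhs_closedballP _ _).1 (filterI (filterI xU xmin) fx).
exists d%:num; split=> // z zd.
have BE w : `|xbar - w| <= d%:num -> closed_ball xbar d%:num w.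
  by rewrite closed_ballE.
have [[Uz zmin] fz] := dP z (BE z zd); split=> //.
  by have := le_trans (ler_norm _) fz; lra.
by exists U => // w wd; have [[]] := dP w (BE w wd).
Qed.

Lemma penalized_minimizer (e : R) : 0 < e ->
  exists (x : X) (k : R), [/\ C x, `|x - xbar| < e, 0 <= k &
    \forall z \near x, C z ->
      f x + k * dist_set K (G x) <= f z + k * dist_set K (G z) + e * `|z - x|].
Proof.
move=> e0; have [d [d0 dP]] := local_minimizer_ball.
pose S := C `&` [set z | `|xbar - z| <= d].
have [[Cxbar Kxbar] _] := xbar_min.
have Sxbar : S xbar by split=> //=; rewrite subrr normr0 ltW.
have cS : closed S.
  apply: closedI => //.
  have -> : [set z | `|xbar - z| <= d] = closed_ball xbar d.
    by rewrite closed_ballE.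
  exact: closed_ball_closed.
have cvxS : convex_set (S : set (convex_lmodType X)).
  apply/convex_setP => z w t t01 [Cz zd] [Cw wd]; split.
    exact: convex_set_comb.
  exact: (convex_set_comb (@convex_ball _ _ xbar d)).
have cphi k : continuous (fun z => f z + k * dist_set K (G z)).
  move=> z; apply: cvgD; first exact/differentiable_continuous/f_C1.1.
  have cG : {for z, continuous G} by exact/differentiable_continuous/G_C1.1.
  have cd : dist_set K (G w) @[w --> z] --> dist_set K (G z).
    apply: (@cvg_comp _ _ _ G (dist_set K) _ _ _ cG).
    exact: continuous_dist_set.
  exact: cvgMl_tmp.
have /choice[x xP] (k : nat) : exists x, [/\ S x,
    f x + k.+1%:R * dist_set K (G x) + e * `|x - xbar| <= f xbar &
    forall z, S z -> f x + k.+1%:R * dist_set K (G x) <=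
      f z + k.+1%:R * dist_set K (G z) + e * `|z - x|].
  have [|x [Sx x1 x2]] :=
      @ekeland _ _ S _ (f xbar - 1) e xbar cS (cphi k.+1%:R) _ Sxbar e0.
    move=> z [Cz /dP[_ fz _]]; apply: (le_trans fz).
    by rewrite lerDl mulr_ge0// dist_set_ge0.
  by exists x; split=> //; move: x1; rewrite (dist_set_eq0 Kxbar) mulr0 addr0.
(* The bound [e] is the claim; the bound [d] puts [x k] inside the ball, so that minimality over [S]
   is local minimality over [C]. *)
pose m := Num.min e d.
have m0 : 0 < m by rewrite lt_min e0.
suff [k km] : exists k, `|x k - xbar| < m.
  have [[Cx xd] _ xmin] := xP k.
  exists (x k), k.+1%:R; split=> //.
    by apply: (lt_le_trans km); rewrite ge_min lexx.
  have : `|x k - xbar| < d by apply: (lt_le_trans km); rewrite ge_min lexx orbT.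
  rewrite -subr_gt0 => r0.
  apply/nbhs_ballP; exists (d - `|x k - xbar|) => // z.
  rewrite -ball_normE /= => zx Cz; apply: xmin; split=> //=.
  have := ler_distD (x k) xbar z; move: zx; rewrite [`|x k - xbar|]distrC.
  by lra.
apply: contrapT => /forallNP xm.
have {}xm k : m <= `|x k - xbar| by rewrite leNgt; apply/negP/xm.
have Sx k : S (x k) by have [] := xP k.
have xbnd k : `|x k| <= `|xbar| + d.
  have [_ /= xd] := Sx k; have := ler_normB xbar (xbar - x k).
  by rewrite opprB addrC subrK; lra.
have [sigma [y [sigma_ge xy]]] := reflexive_weak_subsequence X_reflexive xbnd.
have S0 : S !=set0 by exists xbar.
have Sy : S y.
  apply: closed_dist_set0 => //.
  by apply: (weak_limit_dist_set S0 cvxS _ xy); apply: filterE => k; exact: Sx.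
have [Cy yd] := Sy.
have [ymin _ [U Ulsc dU]] := dP y yd.
(* Staying at distance [m] from [xbar] costs a fixed amount [e m], a gap that survives the weak
   limit. *)
have fx k : f (x k) + k.+1%:R * dist_set K (G (x k)) <= f xbar - e * m.
  have [_ xk _] := xP k; have := ler_wpM2l (ltW e0) (xm k); lra.
(* Since [f (x k) >= f xbar - 1], the penalty term is at most 1. *)
have distx k : dist_set K (G (x k)) <= k.+1%:R^-1.
  have [_ fk _] := dP _ (Sx k).2.
  rewrite -[leRHS]mul1r ler_pdivlMr ?ltr0n// mulrC.
  by have := fx k; have := mulr_gt0 e0 m0; lra.
have Ky : K (G y).
  apply: G_cond xy _ => //= [k|]; first by have [] := Sx (sigma k).
  apply/cvgrPdist_lt => r r0; near=> j.
  rewrite sub0r normrN ger0_norm ?dist_set_ge0//.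
  apply: (le_lt_trans (distx _)); apply: (@le_lt_trans _ _ j.+1%:R^-1).
    by rewrite lef_pV2 ?posrE ?ltr0n// ler_nat ltnS.
  by near: j; exact: (near_infty_natSinv_lt (PosNum r0)).
have := Ulsc (x \o sigma) y (fun k => dU _ (Sx (sigma k)).2) (dU _ yd) xy.
apply/negP; rewrite -ltNge.
apply: (@le_lt_trans _ _ (f xbar - e * m)%:E).
  apply: limn_einf_le => k /=; have := fx (sigma k).
  have : 0 <= (sigma k).+1%:R * dist_set K (G (x (sigma k))).
    by rewrite mulr_ge0// dist_set_ge0.
  lra.
rewrite lte_fin; apply: lt_le_trans (ymin (conj Cy Ky)).
by rewrite gtrDl oppr_lt0 mulr_gt0.
Unshelve. all: by end_near.
Qed.

(** The penalty [k d_K] is nonnegative and vanishes on [K], so its subgradients at [G x] satisfy the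
    inequality on [K] without error. *)
Lemma approximate_multipliers (e : R) : 0 < e ->
  exists (x : X) (lambda : dual Y) (eta : dual X),
    [/\ `|x - xbar| < e, `|eta| <= e,
        normal_cone C x (eta - lagrangian_dx f G x lambda) &
        forall y, K y -> lambda (y - G x) <= 0].
Proof.
move=> e0; have [x [k [Cx xe k0 xmin]]] := penalized_minimizer e0.
pose g y := k * dist_set K y.
have gk u v : g u - g v <= k * `|u - v|.
  by rewrite -mulrBr ler_wpM2l// dist_set_lipschitz.
have cg : convex_on_space g.
  move=> u v t t01; rewrite !mulrA ![_ * k]mulrC -!mulrA -mulrDr.
  by rewrite ler_wpM2l//; exact: convex_dist_set.
have df := f_C1.1 x; have dG := G_C1.1 x.
have lin := linearized_minimizer C_convex Cx k0 cg gk df dG xmin.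
have [lambda [eta [etae lambdag etaC]]] :=
  exists_multipliers C_convex Cx k0 (ltW e0) cg gk lin.
exists x, lambda, eta; split=> //.
  split=> // z Cz; apply: le_trans (etaC z Cz).
  by rewrite -(lagrangian_dxE lambda (z - x) df dG).
move=> y Ky; apply: (le_trans (lambdag y)).
by rewrite /g (dist_set_eq0 Ky) mulr0 sub0r oppr_le0 mulr_ge0// dist_set_ge0.
Qed.

End PenalizedMinimizers.

(** * From strong to weak stationarity, and the limit of vanishing accuracy *)

Lemma cvg_weak_star (X : normedModType R) (eps : (dual X)^nat) (l : dual X) :
  eps @ \oo --> l -> weak_star_cvg eps l.
Proof.
move=> epsl x; apply/cvgrPdist_lt => e e0.
have x1 : 0 < 1 + `|x| by rewrite ltr_pwDl.
have /cvgrPdist_lt/(_ _ (divr_gt0 e0 x1)) := epsl.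
apply: filterS => k; rewrite ltr_pdivlMr//; apply: le_lt_trans.
apply: (le_trans (le_opnorm (l - eps k) x)).
by rewrite ler_wpM2l ?opnorm_ge0// lerDr.
Qed.

Lemma cvg_weak (X : normedModType R) (u : X^nat) (x : X) :
  u @ \oo --> x -> weak_cvg u x.
Proof.
move=> ux l.
exact: (@cvg_comp _ _ _ u l _ _ _ ux (@bop_continuous _ _ _ l x)).
Qed.

Lemma s_AKKT_w_AKKT (X Y : normedModType R) (f : X -> R) (G : X -> Y)
    (C : set X) (K : set Y) (x : X) :
  s_AKKT_point f G C K x -> w_AKKT_point f G C K x.
Proof.
move=> [Fx [u [lambda [[eps [r [eps0 conds]]] ux]]]]; split=> //.
exists u, lambda; split; last exact: cvg_weak.
by exists eps, r; split=> //; exact: cvg_weak_star.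
Qed.

End AKKT.

Theorem proposition3p3 (R : realType) (X Y : completeNormedModType R)
    (f : X -> R) (G : X -> Y) (C : set X) (K : set Y) (xbar : X)
    (f_C1 : continuously_differentiable f)
    (G_C1 : continuously_differentiable G)
    (C_nonempty : C !=set0) (C_closed : closed C)
    (C_convex : convex_set (C : set (convex_lmodType X)))
    (K_nonempty : K !=set0) (K_closed : closed K)
    (K_convex : convex_set (K : set (convex_lmodType Y)))
    (X_reflexive : reflexive_space X)
    (xbar_min : local_minimizer f G C K xbar)
    (f_wslsc : exists2 U : set X, nbhs xbar U & weakly_seq_lsc_on U f)
    (G_cond : forall (u : X^nat) (x : X), (forall k, C (u k)) -> C x ->
       weak_cvg u x -> dist_set K (G (u k)) @[k --> \oo] --> (0 : R) ->
       K (G x)) :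
  s_AKKT_point f G C K xbar /\ w_AKKT_point f G C K xbar.
Proof.
suff sA : s_AKKT_point f G C K xbar by split=> //; exact: s_AKKT_w_AKKT.
split; first exact: xbar_min.1.
have /choice[a aP] (k : nat) : exists a : X * dual Y * dual X,
    [/\ `|a.1.1 - xbar| < k.+1%:R^-1, `|a.2| <= k.+1%:R^-1,
        normal_cone C a.1.1 (a.2 - lagrangian_dx f G a.1.1 a.1.2) &
        forall y, K y -> a.1.2 (y - G a.1.1) <= 0].
  have k0 : 0 < k.+1%:R^-1 :> R by rewrite invr_gt0 ltr0n.
  have [x [lambda [eta aP]]] := approximate_multipliers f_C1 G_C1 C_closed
    C_convex K_nonempty K_convex X_reflexive xbar_min f_wslsc G_cond k0.
  by exists (x, lambda, eta).
exists (fun k => (a k).1.1), (fun k => (a k).1.2); split.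
  (* The error bounds [r] are taken to be zero, as the multiplier inequality holds exactly. *)
  exists (fun k => (a k).2), (fun=> 0); split.
    apply/cvgr0Pnorm_lt => e e0; near=> k.
    have [_ ak _ _] := aP k; apply: (le_lt_trans ak).
    by near: k; exact: (near_infty_natSinv_lt (PosNum e0)).
  split=> [k|//||k]; [by have [_ _ []] := aP k|exact: cvg_cst|].
  by have [_ _ nC lK] := aP k; split.
apply/cvgrPdist_lt => e e0; near=> k.
have [ak _ _ _] := aP k; rewrite distrC; apply: (lt_trans ak).
by near: k; exact: (near_infty_natSinv_lt (PosNum e0)).
Unshelve. all: by end_near.
Qed.
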